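(* Let $A$ be a finite set with $|A|\ge 3$. A congruence lattice $\operatorname{Con}(A,f)$ with a nontrivial permutation $f$ of $A$ is meet-irreducible in $\mathcal{E}$ if and only if $f$ is of prime power order $p^m$ with at least two cycles of length $p^m$.
   Context: $\operatorname{Eq}(A)$ is the set of all equivalence relations on $A$. A mapping $f\colon A\to A$ preserves $\kappa\in\operatorname{Eq}(A)$ if $(x,y)\in\kappa$ implies $(f(x),f(y))\in\kappa$. For $F\subseteq A^A$, $\operatorname{Con}(A,F)$ is the set of all $\kappa\in\operatorname{Eq}(A)$ preserved by every $f\in F$, and $\operatorname{Con}(A,f):=\operatorname{Con}(A,\{f\})$. $\mathcal{E}:=\{\operatorname{Con}(A,F)\mid F\subseteq A^A\}$, ordered by inclusion; it is a lattice whose meet is intersection and whose greatest element is $\operatorname{Eq}(A)$. An element $m$ different from the greatest element is meet-irreducible if $m=a\wedge b$ implies $m=a$ or $m=b$. $f$ is nontrivial if it is neither the identity nor a constant mapping. The order of $f$ is its order in the symmetric group on $A$; $p$ denotes a prime and $m\ge 1$. *)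

(* Defs.v *)
From mathcomp Require Import all_boot all_fingroup.

Set Implicit Arguments.
Unset Strict Implicit.
Unset Printing Implicit Defensive.

Section CongruenceLattices.
Variable A : finType.

(* A binary relation on A is represented by its graph, a set of pairs. *)
Definition is_equivalence (k : {set A * A}) : bool :=
  [&& [forall x, (x, x) \in k],
      [forall x, forall y, ((x, y) \in k) ==> ((y, x) \in k)]
    & [forall x, forall y, forall z,
         ((x, y) \in k) ==> ((y, z) \in k) ==> ((x, z) \in k)]].

Definition Eqs : {set {set A * A}} := [set k | is_equivalence k].

Definition preserves (f : A -> A) (k : {set A * A}) : bool :=
  [forall x, forall y, ((x, y) \in k) ==> ((f x, f y) \in k)].

Definition Con (F : {set {ffun A -> A}}) : {set {set A * A}} :=
  [set k in Eqs | [forall f in F, preserves f k]].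

Definition Con1 (f : A -> A) : {set {set A * A}} := Con [set finfun f].

Definition calE : {set {set {set A * A}}} :=
  [set Con F | F : {set {ffun A -> A}}].

Lemma Con0 : Con set0 = Eqs.
Proof.
apply/setP=> k; rewrite inE; apply: andb_idr => _.
by apply/forall_inP=> f; rewrite inE.
Qed.

Lemma ConU F G : Con (F :|: G) = Con F :&: Con G.
Proof.
apply/setP=> k; rewrite !inE; case: (is_equivalence k) => //=.
apply/forall_inP/andP=> [FGk | [/forall_inP Fk /forall_inP Gk] f].
  by split; apply/forall_inP=> f fF; apply: FGk; rewrite inE fF ?orbT.
by rewrite inE => /orP[/Fk | /Gk].
Qed.

(* These facts justify taking :&: as the meet and Eqs as the top of the
   inclusion order on calE. *)
Lemma Eqs_in_calE : Eqs \in calE.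
Proof. by rewrite -Con0 imset_f. Qed.

Lemma calE_sub_Eqs a : a \in calE -> a \subset Eqs.
Proof. by case/imsetP=> F _ ->; apply/subsetP=> k; rewrite inE => /andP[]. Qed.

Lemma calEI a b : a \in calE -> b \in calE -> a :&: b \in calE.
Proof. by case/imsetP=> F _ -> /imsetP[G _ ->]; rewrite -ConU imset_f. Qed.

Definition meet_irreducible (m : {set {set A * A}}) : Prop :=
  [/\ m \in calE, m != Eqs &
      forall a b, a \in calE -> b \in calE -> m = a :&: b -> m = a \/ m = b].

Definition nontrivial (f : A -> A) : Prop :=
  ~ (forall x, f x = x) /\ ~ (exists c, forall x, f x = c).

End CongruenceLattices.

(* Main.v *)
Require Import Defs.
From mathcomp Require Import all_boot all_fingroup all_solvable.

(** Every element of the lattice is a meet of lattices Con(g) of single maps g.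
   So Con(f), when it is not the top element, is meet-irreducible exactly when
   every family of maps g with Con(f) as the meet of the Con(g) has a member
   with Con(g) = Con(f).

   The basic obstruction (sub_Con1_porbit) is that Con(s) can be contained in
   Con(f), for permutations f and s, only if f maps every point into its own
   s-cycle: otherwise, as A has a third point, a block made of one or two
   s-cycles is respected by s but not by f.  In particular, if s is a power of f, then the two have the
   same cycles and the order of f divides that of s (sub_Con1_order).

   Suppose Con(f) is meet-irreducible.  Writing f as the product of its p-part
   and its p'-part, which are powers of f, forces the order of f to be p^n with
   n > 0.  Let h = f^(p^(n-1)); the points moved by h are those in the cycles of
   length p^n.  If there were only one such cycle C, then a congruence of f
   that relates some v in C to another point would also relate v to h v,
   because the congruences of f inside C form a chain whose least nontrivial
   member is given by the h-cycles, and because h fixes all points outside C.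
   Hence every map that first sends v to h v and then applies f preserves all
   of Con(f).  These maps, for v in C, together determine Con(f), although
   none of them does so alone (redirect_Con1_proper), a contradiction.

   Conversely, let C and D be distinct cycles of the maximal length p^n.  For x
   in C and z outside C, mapping f^i x to f^i z and fixing all points outside C
   is a well-defined retraction that commutes with f, so its kernel is in
   Con(f).  Any map g that preserves these kernels, and the equivalences with
   the single nontrivial block C or D, is constant or a power of f
   (Con1_const_or_power).  So either Con(g) = Con(f), or Con(g) contains
   Con(f^p), which is not contained in Con(f).  If all
   members of a family were of the second kind, the meet would contain Con(f^p)
   and hence differ from Con(f). *)

Section CongruenceLatticesOfPermutations.

Set Implicit Arguments.
Unset Strict Implicit.
Local Open Scope group_scope.

Variable A : finType.
Implicit Types (f s h : {perm A}) (g : A -> A) (x y z u v : A).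
Implicit Types (F G : {set {ffun A -> A}}) (k : {set A * A}) (S : {set A}).

(** * Cycles and powers of a permutation *)

Lemma expg_fix s n x : ((s ^+ n) x == x) = (#|porbit s x| %| n)%N.
Proof.
set c := #|_|; have c_gt0 : (0 < c)%N by rewrite lt0n card_porbit_neq0.
have fixM q : iter (q * c) s x = x by rewrite iterM iter_fix // iter_porbit.
rewrite permX {1}(divn_eq n c) addnC iterD fixM -[eqbRHS]/(iter 0 s x).
rewrite -(nth_traject s (ltn_pmod n c_gt0)) -(nth_traject s c_gt0).
by rewrite nth_uniq ?size_traject ?ltn_pmod ?uniq_traject_porbit.
Qed.

Lemma expg_fix_porbit s n x y : y \in porbit s x ->
  ((s ^+ n) y == y) = ((s ^+ n) x == x).
Proof. by rewrite -eq_porbit_mem !expg_fix => /eqP->. Qed.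

Lemma card_porbit_dvd s x : (#|porbit s x| %| #[s])%N.
Proof. by rewrite -expg_fix expg_order perm1. Qed.

Lemma order_dvd_porbits s n :
  (forall x, #|porbit s x| %| n)%N -> (#[s] %| n)%N.
Proof.
move=> cyc_n; rewrite order_dvdn; apply/eqP/permP=> x; rewrite perm1.
by apply/eqP; rewrite expg_fix.
Qed.

(** A cycle whose length is the order of s is a regular orbit of the group
   generated by s. *)
Lemma expg_inj_max s x i j :
  #|porbit s x| = #[s] -> (s ^+ i) x = (s ^+ j) x -> s ^+ i = s ^+ j.
Proof.
move=> max_x; wlog le_ij : i j / (i <= j)%N => [IH | ].
  by have [/IH//| /ltnW/IH IH' /esym/IH'] := leqP i j.
rewrite -(subnK le_ij) expgD permM => /perm_inj/esym/eqP.
by rewrite expg_fix max_x order_dvdn => /eqP->; rewrite mul1g.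
Qed.

Lemma porbit_expg s n x y : ((s ^+ n) y \in porbit s x) = (y \in porbit s x).
Proof. by rewrite porbit_sym porbit_perm porbit_sym. Qed.

Lemma porbit_step s x y : (s y \in porbit s x) = (y \in porbit s x).
Proof. exact: (porbit_expg s 1). Qed.

Lemma porbit_disjoint s x y u :
  y \notin porbit s x -> u \in porbit s x -> u \notin porbit s y.
Proof. by rewrite -!eq_porbit_mem => neq_yx /eqP->; rewrite eq_sym. Qed.

(** * Congruence lattices *)

Lemma EqsP k :
  reflect [/\ forall x, (x, x) \in k, forall x y, (x, y) \in k -> (y, x) \in k
            & forall x y z, (x, y) \in k -> (y, z) \in k -> (x, z) \in k]
          (k \in Eqs A).
Proof.
rewrite inE; apply: (iffP and3P) => -[r s t]; split.
- exact/forallP.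
- by move=> x y; apply/implyP; move/forallP/(_ x)/forallP: s; apply.
- move=> x y z xy yz; move/forallP/(_ x)/forallP/(_ y)/forallP/(_ z): t.
  by rewrite xy yz.
- exact/forallP.
- by apply/forallP=> x; apply/forallP=> y; apply/implyP/s.
apply/forallP=> x; apply/forallP=> y; apply/forallP=> z.
by apply/implyP=> xy; apply/implyP; apply: t xy.
Qed.

Lemma Con1P g k :
  reflect (k \in Eqs A /\ forall x y, (x, y) \in k -> (g x, g y) \in k)
          (k \in Con1 g).
Proof.
rewrite [k \in Con1 g]inE; apply: (iffP andP) => -[k_eq g_k]; split=> //.
  move=> x y.
  have /forallP/(_ x)/forallP/(_ y)/implyP := forall_inP g_k _ (set11 _).
  by rewrite !ffunE.
apply/forall_inP=> _ /set1P->; apply/forallP=> x; apply/forallP=> y.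
by rewrite !ffunE; apply/implyP/g_k.
Qed.

Lemma Con1_ffun (g : {ffun A -> A}) : Con1 g = Con [set g].
Proof. by rewrite /Con1 ffunK. Qed.

Lemma ConS F G : F \subset G -> Con G \subset Con F.
Proof. by move/setUidPr <-; rewrite ConU subsetIl. Qed.

Lemma Con_sub1 F (g : {ffun A -> A}) : g \in F -> Con F \subset Con1 g.
Proof. by move=> Fg; rewrite Con1_ffun ConS ?sub1set. Qed.

Lemma Con_glb F k : k \in Eqs A ->
  (forall g : {ffun A -> A}, g \in F -> k \in Con1 g) -> k \in Con F.
Proof.
move=> k_eq kF; rewrite inE; apply/andP; split=> //; apply/forall_inP=> g /kF.
rewrite Con1_ffun inE => /andP[_ /forall_inP]; apply; exact: set11.
Qed.

Definition kernel (T : eqType) (phi : A -> T) : {set A * A} :=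
  [set u | phi u.1 == phi u.2].

Lemma kernel_Eqs (T : eqType) (phi : A -> T) : kernel phi \in Eqs A.
Proof.
apply/EqsP; split=> [x|x y|x y z]; rewrite !inE //= 1?eq_sym //.
by move/eqP->.
Qed.

(** The equivalence whose only possibly nontrivial class is S. *)
Definition block S : {set A * A} :=
  kernel (fun u => if u \in S then None else Some u).

Lemma in_block S u v :
  ((u, v) \in block S) = (u == v) || (u \in S) && (v \in S).
Proof.
rewrite inE /=; have [->|] := eqVneq u v; first by rewrite eqxx.
by case: ifP; case: ifP => //= _ _ /negPf <-; rewrite (inj_eq Some_inj).
Qed.

Lemma blockP S g :
  block S \in Con1 g <->
  (forall u v, u \in S -> v \in S -> g u = g v \/ g u \in S /\ g v \in S).
Proof.
split=> [/Con1P[_ gS] u v Su Sv | gS].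
  have /gS : (u, v) \in block S by rewrite in_block Su Sv orbT.
  by rewrite in_block => /orP[/eqP|/andP]; [left | right].
apply/Con1P; split=> [|u v]; first exact: kernel_Eqs.
rewrite !in_block => /orP[/eqP-> | /andP[Su Sv]]; first by rewrite eqxx.
by have [-> | [-> ->]] := gS u v Su Sv; rewrite ?eqxx ?orbT.
Qed.

Lemma stable_block S g : {homo g : u / u \in S} -> block S \in Con1 g.
Proof. by move=> gS; apply/blockP=> u v /gS gu /gS gv; right. Qed.

Lemma Con1_cycle s h : h \in <[s]> -> Con1 s \subset Con1 h.
Proof.
case/cycleP=> n ->; apply/subsetP=> k /Con1P[k_eq s_k]; apply/Con1P; split=> //.
by move=> x y kxy; rewrite !permX; elim: n => //= n; apply: s_k.
Qed.

Lemma Con1_expg_rel s k x n :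
  k \in Con1 s -> (x, s x) \in k -> (x, (s ^+ n) x) \in k.
Proof.
case/Con1P=> /EqsP[refl _ trans] s_k kxsx; rewrite permX.
elim: n => [|n IHn]; first exact: refl.
by apply: trans IHn _; elim: n => //= n; apply: s_k.
Qed.

(** If y = f x lies outside the s-cycle of x, pick a third point z.  When z is
   not in the s-cycle of y, the union of the s-cycles of x and z is a block
   that s respects and f does not, since f maps x to y, which is outside it.
   When z is in the s-cycle of y, that cycle is such a block for the inverse
   of f, which maps y to x outside it. *)
Lemma sub_Con1_porbit f s :
  (3 <= #|A|)%N -> Con1 s \subset Con1 f -> forall x, f x \in porbit s x.
Proof.
move=> A3 /subsetP s_f x; apply: contraLR A3 => fx_x; rewrite -ltnNge ltnS.
have neq_fx : f x != x by apply: contraNneq fx_x => ->; apply: porbit_id.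
have fV : f^-1 \in <[f]> by rewrite groupV cycle_id.
suffices A2 : [set: A] \subset [set x; f x].
  by rewrite -cardsT (leq_trans (subset_leq_card A2)) // cards2; case: eqP.
apply/subsetP=> z _; rewrite !inE; apply/norP=> -[neq_zx neq_zfx].
have [z_fx | z_nfx] := boolP (z \in porbit s (f x)).
  have /s_f/(subsetP (Con1_cycle fV))/blockP/(_ (f x) z) :
      block (porbit s (f x)) \in Con1 s.
    by apply: stable_block => u; rewrite porbit_step.
  rewrite porbit_id permK => /(_ isT z_fx)[xz | [x_fx _]].
    by rewrite xz permKV eqxx in neq_zfx.
  by rewrite porbit_sym x_fx in fx_x.
have /s_f/blockP/(_ x z) : block (porbit s x :|: porbit s z) \in Con1 s.
  by apply: stable_block => u; rewrite !inE !porbit_step.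
rewrite !inE !porbit_id orbT /= => /(_ isT isT)[/perm_inj xz | []].
  by rewrite xz eqxx in neq_zx.
by rewrite (negPf fx_x) porbit_sym (negPf z_nfx).
Qed.

Lemma sub_Con1_order f s : (3 <= #|A|)%N -> s \in <[f]> ->
  Con1 s \subset Con1 f -> (#[f] %| #[s])%N.
Proof.
move=> A3 fs s_f; apply: order_dvd_porbits => x.
suffices -> : porbit f x = porbit s x by apply: card_porbit_dvd.
apply/setP=> y; apply/idP/idP=> /porbitP[i ->].
  rewrite permX; elim: i => [|i IHi]; first exact: porbit_id.
  move: (sub_Con1_porbit A3 s_f (iter i f x)).
  by rewrite -!eq_porbit_mem in IHi *; rewrite (eqP IHi).
by have /cycleP[j ->] := fs; rewrite -expgM mem_porbit.
Qed.

Lemma meet_irreducible_generator F : meet_irreducible (Con F) ->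
  exists2 g : {ffun A -> A}, g \in F & Con F = Con1 g.
Proof.
move: {2}#|F| (leqnn #|F|) => n; elim: n F => [|n IHn] F.
  by rewrite leqn0 cards_eq0 => /eqP-> [_]; rewrite Con0 eqxx.
move=> Fn irrF; have [F0 | /set0Pn[g Fg]] := eqVneq F set0.
  by case: irrF => _; rewrite F0 Con0 eqxx.
have defF : Con F = Con1 g :&: Con (F :\ g) by rewrite Con1_ffun -ConU setD1K.
have [_ _ /(_ _ _ _ _ defF)] := irrF.
rewrite Con1_ffun !imset_f // => -[] // defF'.
  by exists g; rewrite ?Con1_ffun.
have [||g' /setD1P[_ Fg'] defg'] := IHn (F :\ g).
- by rewrite (cardsD1 g F) Fg in Fn.
- by rewrite -defF'.
by exists g'; rewrite ?defF'.
Qed.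

(** * Meet-irreducibility forces two maximal cycles of prime power length *)

(** The p-part and the p'-part of f are powers of f with product f, so Con(f) is
   the meet of their congruence lattices.  It must then equal one of them, and
   that part has the same order as f: this is impossible for the p'-part if p
   divides the order of f. *)
Lemma meet_irreducible_prime_power f : (3 <= #|A|)%N -> f != 1 ->
  meet_irreducible (Con1 f) -> exists p m, prime p /\ #[f] = (p ^ m.+1)%N.
Proof.
move=> A3 ntf [_ _ irr_f].
have of1 : (1 < #[f])%N by rewrite order_gt1.
set p := pdiv #[f]; have p_pr : prime p by apply: pdiv_prime.
have p_f : (p %| #[f])%N by apply: pdiv_dvd.
have defF : Con1 f = Con1 f.`_p :&: Con1 f.`_p^'.
  apply/eqP; rewrite eqEsubset subsetI !Con1_cycle ?cycle_constt //=.
  apply/subsetP=> k /setIP[/Con1P[k_eq p_k] /Con1P[_ p'_k]]; apply/Con1P.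
  by split=> // x y /p_k/p'_k; rewrite -!permM consttC.
have [] := irr_f _ _ (imset_f _ _) (imset_f _ _) defF => // defC.
  have : p.-nat #[f].
    apply: pnat_dvd (p_elt_constt p f).
    by apply: sub_Con1_order; rewrite ?cycle_constt ?defC.
  case/p_natP=> -[|m] of_; first by rewrite of_ in of1.
  by exists p, m.
have : (p %| #[f.`_p^'])%N.
  by apply: dvdn_trans p_f _; apply: sub_Con1_order; rewrite ?cycle_constt ?defC.
move=> /(pnat_dvd)/(_ (p_elt_constt p^' f)).
by rewrite pnatE // !inE eqxx.
Qed.

(** The subgroups of a cyclic p-group form a chain, so the one of order p is
   contained in every nontrivial one. *)
Lemma mem_cycle_socle f s p m : prime p -> #[f] = (p ^ m.+1)%N ->
  s \in <[f]> -> s != 1 -> f ^+ (p ^ m) \in <[s]>.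
Proof.
move=> p_pr of_ fs nts; rewrite -cycle_subG.
rewrite -(cardSg_cyclic (cycle_cyclic f)) ?cycle_subG ?mem_cycle //.
have oh : #|<[f ^+ (p ^ m)]>| = p.
  by have := orderXexp m of_; rewrite subSnn expn1.
rewrite oh -[#|<[s]>|]/(#[s]).
have /(dvdn_pfactor _ _ p_pr)[[|i] _ os] : (#[s] %| p ^ m.+1)%N.
- by rewrite -of_ order_dvdG.
- by rewrite -order_gt1 os in nts.
by rewrite os dvdn_exp.
Qed.

Lemma moved_max_cycle f p m x : prime p -> #[f] = (p ^ m.+1)%N ->
  ((f ^+ (p ^ m)) x != x) = (#|porbit f x| == (p ^ m.+1)%N).
Proof.
move=> p_pr of_; rewrite expg_fix.
have /(dvdn_pfactor _ _ p_pr)[i le_i ->] : (#|porbit f x| %| p ^ m.+1)%N.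
  by rewrite -of_ card_porbit_dvd.
rewrite dvdn_Pexp2l ?eqn_exp2l ?prime_gt1 // -ltnNge.
by rewrite eqn_leq le_i.
Qed.

(** A congruence relating v to f^i v relates v to its whole f^i-cycle, which
   contains h v by the lemma mem_cycle_socle, where h is the power of f in the
   conclusion.  If instead y lies outside the cycle of v, then h fixes y, and
   applying h shows that y is related to h v as well as to v. *)
Lemma Con1_minimal_step f p m k v y : prime p -> #[f] = (p ^ m.+1)%N ->
  (forall z, (f ^+ (p ^ m)) z != z -> z \in porbit f v) ->
  k \in Con1 f -> (v, y) \in k -> y != v -> (v, (f ^+ (p ^ m)) v) \in k.
Proof.
move=> p_pr of_ one_max f_k kvy neq_yv; set h := f ^+ _ in one_max *.
have /Con1P[/EqsP[_ sym trans] _] := f_k.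
have [/porbitP[i def_y] | y_v] := boolP (y \in porbit f v).
  have nts : f ^+ i != 1.
    by apply: contra_neq neq_yv => f1; rewrite def_y f1 perm1.
  rewrite /h.
  have /cycleP[j ->] := mem_cycle_socle p_pr of_ (mem_cycle f i) nts.
  apply: Con1_expg_rel; last by rewrite -def_y.
  by apply: subsetP f_k; rewrite Con1_cycle ?mem_cycle.
have hy : h y = y by apply/eqP; apply: contraNT y_v; apply: one_max.
have /Con1P[_ /(_ _ _ kvy)] : k \in Con1 h.
  by apply: subsetP f_k; rewrite Con1_cycle ?mem_cycle.
by rewrite hy => /sym; apply: trans.
Qed.

Definition redirect f u v : {ffun A -> A} :=
  [ffun x => f (if x == v then u else x)].

(** The map redirect f u v identifies u and v, so it respects the block {u, v};
   f does not, unless f exchanges u and v.  In that case the map fixes v and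
   u is the image of no point, so it respects the complement of u, whereas f
   moves v out of this complement, which has a point besides v. *)
Lemma redirect_Con1_proper f u v : (3 <= #|A|)%N -> u != v -> f v != v ->
  Con1 f != Con1 (redirect f u v).
Proof.
move=> A3 neq_uv fv; apply/eqP=> defC.
have : block [set v; u] \in Con1 (redirect f u v).
  apply/blockP=> x y; rewrite !inE !ffunE => x_vu y_vu; left.
  by case: eqP x_vu => [_ _ | _ /eqP->]; case: eqP y_vu => [_ _ | _ /eqP->].
rewrite -defC => /blockP/(_ v u); rewrite !inE !eqxx orbT (negPf fv) /=.
case=> // [/perm_inj vu | [/eqP fvu fu]]; first by rewrite vu eqxx in neq_uv.
have {}fu : f u = v.
  case/orP: fu => /eqP // fu; case/eqP: neq_uv.
  by apply: (@perm_inj _ f); rewrite fu fvu.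
have : block [set~ u] \in Con1 (redirect f u v).
  apply: stable_block => x; rewrite !inE ffunE => neq_xu.
  have [_ | neq_xv] := eqVneq x v; first by rewrite fu eq_sym.
  by rewrite -fvu (inj_eq perm_inj).
rewrite -defC => /blockP irr.
suffices A2 : [set: A] \subset [set v; u].
  move: A3; rewrite -cardsT ltnNge (leq_trans (subset_leq_card A2)) //.
  by rewrite cards2; case: eqP.
apply/subsetP=> z _; rewrite !inE; apply/norP=> -[neq_zv neq_zu].
have := irr v z; rewrite !inE eq_sym neq_uv neq_zu fvu eqxx /=.
by case=> // [|[]//]; rewrite -{1}fvu => /perm_inj vz; rewrite vz eqxx in neq_zv.
Qed.

(** By Con1_minimal_step, moving v to h v does not leave the classes of a
   congruence of f, unless v is a singleton class, so each of these maps
   preserves Con(f).  Conversely, redirect f (h v) v acts on x and y as f does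
   if v is distinct from both; such a v exists in the cycle of w unless that cycle
   is {x, y}, which f then just swaps. *)
Lemma Con1_single_max_cycle f p m w : prime p -> #[f] = (p ^ m.+1)%N ->
  let h := f ^+ (p ^ m) in h w != w ->
  (forall z, h z != z -> z \in porbit f w) ->
  Con1 f = Con [set redirect f (h v) v | v in porbit f w].
Proof.
move=> p_pr of_ h hw one_max.
have hv v : v \in porbit f w -> h v != v.
  by move/(expg_fix_porbit (p ^ m)) => fix_v; rewrite fix_v.
have fv v : v \in porbit f w -> f v != v.
  by move/hv; apply: contraNneq => fv; rewrite /h permX iter_fix.
apply/eqP; rewrite eqEsubset; apply/andP; split; apply/subsetP=> k.
  move=> f_k; have /Con1P[k_eq fk] := f_k; have /EqsP[refl sym trans] := k_eq.
  apply: Con_glb => // _ /imsetP[v Cv ->]; apply/Con1P; split=> // x y kxy.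
  have vh z : (v, z) \in k -> z != v -> (v, h v) \in k.
    apply: (@Con1_minimal_step f p m) => // u /one_max.
    by move: Cv; rewrite -eq_porbit_mem => /eqP->.
  rewrite !ffunE; apply: fk.
  have [xv | neq_xv] := eqVneq x v; have [yv | neq_yv] := eqVneq y v => //.
  - by rewrite xv in kxy; apply: trans (kxy); apply: sym; apply: vh kxy _.
  - by rewrite yv in kxy; apply: trans (kxy) _; apply: vh (sym _ _ kxy) _.
move=> F_k; have k_eq : k \in Eqs A by case/setIdP: F_k.
have /EqsP[refl sym trans] := k_eq; apply/Con1P; split=> // x y kxy.
have [/existsP[v /and3P[Cv vx vy]] | none] :=
    boolP [exists v, [&& v \in porbit f w, v != x & v != y]].
  have /Con_sub1/subsetP/(_ k F_k) : redirect f (h v) v \in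
      [set redirect f (h v) v | v in porbit f w] by apply: imset_f.
  by case/Con1P=> _ /(_ x y kxy); rewrite !ffunE !ifN // eq_sym.
have Cxy v : v \in porbit f w -> v = x \/ v = y.
  move=> Cv; move: none; rewrite negb_exists => /forallP/(_ v).
  rewrite Cv /= negb_and !negbK.
  by case/orP=> /eqP->; [left | right].
have Cf v : v \in porbit f w -> f v \in porbit f w by rewrite porbit_step.
have Cw := porbit_id f w.
suffices [-> ->] : f x = y /\ f y = x by apply: sym.
have swap u v : u \in porbit f w -> u = x /\ v = y \/ u = y /\ v = x -> f u = v.
  move=> Cu uv; have := Cxy _ (Cf _ Cu); have /eqP := fv _ Cu.
  by case: uv => -[-> ->] fu [].
case: (Cxy _ Cw) => def_w; rewrite {1}def_w in Cw.
  have fx : f x = y by apply: swap => //; left.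
  by split=> //; apply: swap; [rewrite -fx Cf | right].
have fy : f y = x by apply: swap => //; right.
by split=> //; apply: swap; [rewrite -fy Cf | left].
Qed.

Lemma meet_irreducible_two_max_cycles f p m : (3 <= #|A|)%N -> prime p ->
  #[f] = (p ^ m.+1)%N -> meet_irreducible (Con1 f) ->
  (1 < #|[set C in porbits f | #|C| == p ^ m.+1]|)%N.
Proof.
move=> hA p_pr of_ irr_f; rewrite ltnNge; apply/negP=> /card_le1P le1.
set h := (f ^+ (p ^ m)).
have [w hw] : exists w, h w != w.
  apply/existsP; apply: contraTT (prime_gt1 p_pr).
  rewrite negb_exists => /forallP h1.
  have <- : #[h] = p by rewrite (orderXexp m of_) subSnn expn1.
  rewrite order_gt1 negbK; apply/eqP/permP=> u; rewrite perm1.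
  by apply/eqP; move: (h1 u); rewrite negbK.
have maxP u : h u != u ->
    porbit f u \in [set C in porbits f | #|C| == (p ^ m.+1)%N].
  by rewrite inE imset_f //= (moved_max_cycle _ p_pr of_).
have one_max u : h u != u -> u \in porbit f w.
  by move/maxP; rewrite (le1 _ (maxP w hw)) inE => /eqP<-; apply: porbit_id.
have defF := Con1_single_max_cycle p_pr of_ hw one_max.
rewrite defF in irr_f.
have [g /imsetP[v Cv ->]] := meet_irreducible_generator irr_f.
rewrite -defF; apply/eqP.
have hv : h v != v by rewrite /h (expg_fix_porbit _ Cv).
apply: redirect_Con1_proper => //.
by apply: contraNneq hv => fv; rewrite /h permX iter_fix.
Qed.

(** * Two maximal cycles of prime power length force meet-irreducibility *)

(** Well defined because the powers of f act regularly on the cycle of x. *)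
Lemma max_retraction f x z : #|porbit f x| = #[f] ->
  exists phi : A -> A, (forall i, phi ((f ^+ i) x) = (f ^+ i) z) /\
                       (forall u, u \notin porbit f x -> phi u = u).
Proof.
move=> max_x; suffices /fin_all_exists[phi phiP] : forall u, exists w,
    (forall i, u = (f ^+ i) x -> w = (f ^+ i) z) /\
    (u \notin porbit f x -> w = u).
  exists phi; split=> [i | u]; last by case: (phiP u).
  by have [+ _] := phiP ((f ^+ i) x); apply.
move=> u; have [/porbitP[i ->] | ] := boolP (u \in porbit f x); last first.
  by move=> x_u; exists u; split=> // i def_u; rewrite def_u mem_porbit in x_u.
by exists ((f ^+ i) z); split=> // j /(expg_inj_max max_x)->.
Qed.

(** The retraction commutes with f, so its kernel, the congruence of f generated
   by (x, z), is preserved by g. *)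
Lemma retraction_rel f g x z : #|porbit f x| = #[f] -> z \notin porbit f x ->
  Con1 f \subset Con1 g ->
  exists phi : A -> A, [/\ forall i, phi ((f ^+ i) x) = (f ^+ i) z,
    forall u, u \notin porbit f x -> phi u = u & phi (g x) = phi (g z)].
Proof.
move=> max_x x_z f_g; have [phi [phiC phiN]] := max_retraction z max_x.
have phiJ u : phi (f u) = f (phi u).
  have [/porbitP[i ->] | x_u] := boolP (u \in porbit f x).
    by rewrite phiC -!permM -!expgSr phiC.
  by rewrite !phiN ?porbit_step.
have : kernel phi \in Con1 g.
  apply: subsetP f_g _ _; apply/Con1P; split=> [|u v]; first exact: kernel_Eqs.
  by rewrite !inE !phiJ => /eqP->.
have phix : phi x = z by have := phiC 0; rewrite expg0 !perm1.
case/Con1P=> _ /(_ x z) ker_g; exists phi; split=> //; apply/eqP.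
by move: ker_g; rewrite !inE /= phix (phiN z) // => ->.
Qed.

Section MaximalCycles.

Variables (f : {perm A}) (g : A -> A).
Hypothesis f_g : Con1 f \subset Con1 g.

Lemma retraction_out x z : #|porbit f x| = #[f] -> z \notin porbit f x ->
  g x \notin porbit f x -> g z = g x \/ g z \in porbit f x.
Proof.
move=> max_x x_z x_gx; have [phi [_ phiN phi_g]] := retraction_rel max_x x_z f_g.
have [x_gz | x_gz] := boolP (g z \in porbit f x); first by right.
by left; rewrite -[RHS]phiN // phi_g phiN.
Qed.

Lemma retraction_in x z i : #|porbit f x| = #[f] -> z \notin porbit f x ->
  g x = (f ^+ i) x -> g z = (f ^+ i) z \/ g z \in porbit f x.
Proof.
move=> max_x x_z gx; have [phi [phiC phiN phi_g]] := retraction_rel max_x x_z f_g.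
have [x_gz | x_gz] := boolP (g z \in porbit f x); first by right.
by left; rewrite -phiC -gx phi_g phiN.
Qed.

Lemma max_cycle_stable x :
  (forall u, u \in porbit f x -> g u = g x) \/
  (forall u, u \in porbit f x -> g u \in porbit f x).
Proof.
have /(subsetP f_g)/blockP gC : block (porbit f x) \in Con1 f.
  by apply: stable_block => u; rewrite porbit_step.
have [Cgx | x_gx] := boolP (g x \in porbit f x); [right | left] => u Cu.
  by have [-> | []] := gC u x Cu (porbit_id f x).
by have [-> | [_ Cgx]] := gC u x Cu (porbit_id f x); last rewrite Cgx in x_gx.
Qed.

Hypothesis of1 : (1 < #[f])%N.

(** Both x and f x have the g-image c, so g z and c are identified by the
   retraction that sends x to z and also by the one that sends f x to z.  On the
   cycle of x these two differ by a shift by f, which moves z; hence they cannot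
   both identify a point of that cycle with a point outside it. *)
Lemma const_max_cycle_spread x z c :
  #|porbit f x| = #[f] -> #|porbit f z| = #[f] -> z \notin porbit f x ->
  (forall u, u \in porbit f x -> g u = c) -> g z = c.
Proof.
move=> max_x max_z x_z gC.
have porbit_fx : porbit f (f x) = porbit f x by apply: (porbit_perm f 1).
have Cfx : f x \in porbit f x by rewrite porbit_step porbit_id.
have [phi [phiC phiN]] := retraction_rel max_x x_z f_g.
have [||psi [psiC psiN]] := @retraction_rel f g (f x) z _ _ f_g;
  rewrite ?porbit_fx //.
rewrite (gC x) ?porbit_id // (gC (f x)) // => psi_g phi_g.
have fz : f z != z.
  by rewrite -[f z]/((f ^+ 1) z) expg_fix max_z dvdn1 neq_ltn of1 orbT.
have split_rel b d : phi b = phi d -> psi b = psi d ->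
    b \in porbit f x -> d \notin porbit f x -> False.
  move=> phi_bd psi_bd Cb x_d; case/eqP: fz.
  have /porbitP[i def_b] : b \in porbit f (f x) by rewrite porbit_fx.
  move: psi_bd phi_bd; rewrite (psiN d) ?porbit_fx // (phiN d) // def_b psiC.
  by rewrite -permM -expgS phiC expgS permM => <- /perm_inj.
have [Cc | x_c] := boolP (c \in porbit f x).
  have [Cgz | x_gz] := boolP (g z \in porbit f x).
    move: phi_g; have [/porbitP[i ->] /porbitP[j ->]] := (Cc, Cgz).
    by rewrite !phiC => /(expg_inj_max max_z)->.
  by case: (split_rel c (g z)).
have [Cgz | x_gz] := boolP (g z \in porbit f x).
  by case: (split_rel (g z) c).
by rewrite -[LHS]phiN // -phi_g phiN.
Qed.

(** On a second maximal cycle g is constant by the previous lemma.  For z in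
   neither of the two cycles, both can be retracted onto the cycle of z.  If g z
   were not c, each of the two cycles would have to contain g z or c, so one
   contains g z and the other c; but then the retraction of the first sends g z
   into the cycle of z and leaves c in the second cycle. *)
Lemma const_max_cycle_const x y c :
  #|porbit f x| = #[f] -> #|porbit f y| = #[f] -> y \notin porbit f x ->
  (forall u, u \in porbit f x -> g u = c) -> forall z, g z = c.
Proof.
move=> max_x max_y x_y gC.
have gD u : u \in porbit f y -> g u = c.
  rewrite -eq_porbit_mem => /eqP uy; apply: const_max_cycle_spread gC => //.
    by rewrite uy.
  by rewrite porbit_sym uy porbit_sym.
move=> z; have [/gC// | x_z] := boolP (z \in porbit f x).
have [/gD// | y_z] := boolP (z \in porbit f y).
have disj := porbit_disjoint x_y.
have gx := gC x (porbit_id f x); have gy := gD y (porbit_id f y).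
have [/porbitP[i def_c] | x_c] := boolP (c \in porbit f x).
  have y_c : c \notin porbit f y by apply: disj; rewrite def_c mem_porbit.
  have [|->//|Dgz] := @retraction_out y z max_y y_z; rewrite ?gy //.
  have [|gz|Cgz] := @retraction_in x z i max_x x_z; rewrite ?gx //.
    by rewrite gz porbit_expg (negPf y_z) in Dgz.
  by rewrite (negPf (disj _ Cgz)) in Dgz.
have [|->//|Cgz] := @retraction_out x z max_x x_z; rewrite ?gx //.
have y_gz := disj _ Cgz.
have [/porbitP[i def_c] | y_c] := boolP (c \in porbit f y).
  have [|gz|Dgz] := @retraction_in y z i max_y y_z; rewrite ?gy //.
    by rewrite gz porbit_expg (negPf x_z) in Cgz.
  by rewrite Dgz in y_gz.
have [|->//|Dgz] := @retraction_out y z max_y y_z; rewrite ?gy //.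
by rewrite Dgz in y_gz.
Qed.

(** If g is not constant on either maximal cycle, it maps each of them into
   itself.  As g x = f^i x for some i, the retraction of the cycle of x onto
   that of y forces g = f^i on the cycle of y.  The retraction of the latter then
   gives g z = f^i z for all z, up to points in the cycle of y, and these are
   excluded by stability or by the retraction from x. *)
Lemma Con1_const_or_power x y :
  #|porbit f x| = #[f] -> #|porbit f y| = #[f] -> y \notin porbit f x ->
  (exists c, forall z, g z = c) \/ (exists i, forall z, g z = (f ^+ i) z).
Proof.
move=> max_x max_y x_y; have y_x : x \notin porbit f y by rewrite porbit_sym.
have [gC | gC] := max_cycle_stable x.
  by left; exists (g x); apply: const_max_cycle_const max_x max_y x_y gC.
have [gD | gD] := max_cycle_stable y.
  by left; exists (g y); apply: const_max_cycle_const max_y max_x y_x gD.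
right; have disj := porbit_disjoint x_y.
have /porbitP[i gx] := gC x (porbit_id f x); exists i.
have gDi u : u \in porbit f y -> g u = (f ^+ i) u.
  move=> Du; have x_u : u \notin porbit f x by apply: contraL Du; apply: disj.
  have [//|Cgu] := retraction_in max_x x_u gx.
  by move: (gD u Du); rewrite (negPf (disj _ Cgu)).
have gy := gDi y (porbit_id f y).
move=> z; have [/gDi// | y_z] := boolP (z \in porbit f y).
have [//|Dgz] := retraction_in max_y y_z gy.
have [Cz | x_z] := boolP (z \in porbit f x).
  by move: (disj _ (gC z Cz)); rewrite Dgz.
have [//|Cgz] := retraction_in max_x x_z gx.
by move: (disj _ Cgz); rewrite Dgz.
Qed.

End MaximalCycles.

Lemma eq_Con1 g1 g2 : g1 =1 g2 -> Con1 g1 = Con1 g2.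
Proof. by move=> eq_g; congr (Con [set _]); apply/ffunP=> x; rewrite !ffunE. Qed.

(** A power f^i generates the same group as f if p does not divide i, and is a
   power of f^p otherwise; a constant map preserves every equivalence. *)
Lemma Con1_above f g p m x y : prime p -> #[f] = (p ^ m.+1)%N ->
  #|porbit f x| = #[f] -> #|porbit f y| = #[f] -> y \notin porbit f x ->
  Con1 f \subset Con1 g -> Con1 g \subset Con1 f \/ Con1 (f ^+ p) \subset Con1 g.
Proof.
move=> p_pr of_ max_x max_y x_y f_g.
have of1 : (1 < #[f])%N by rewrite of_ -(exp1n m.+1) ltn_exp2r ?prime_gt1.
have [[c gc] | [i gi]] := Con1_const_or_power f_g of1 max_x max_y x_y.
  right; apply/subsetP=> k /Con1P[k_eq _]; apply/Con1P; split=> // u v _.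
  by have /EqsP[refl _ _] := k_eq; rewrite !gc.
rewrite (eq_Con1 gi); have [/dvdnP[j ->] | p_i] := boolP (p %| i)%N.
  by right; rewrite mulnC expgM Con1_cycle ?mem_cycle.
left; apply: Con1_cycle.
suffices /eqP<- : generator <[f]> (f ^+ i) by apply: cycle_id.
by rewrite generator_coprime of_ coprimeXl // prime_coprime.
Qed.

Lemma two_max_cycles_meet_irreducible f p m x y : (3 <= #|A|)%N -> prime p ->
  #[f] = (p ^ m.+1)%N -> #|porbit f x| = #[f] -> #|porbit f y| = #[f] ->
  y \notin porbit f x -> meet_irreducible (Con1 f).
Proof.
move=> hA p_pr of_ max_x max_y x_y.
have above g := @Con1_above f g p m x y p_pr of_ max_x max_y x_y.
have oXp : ~~ (Con1 (f ^+ p) \subset Con1 f).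
  apply/negP=> /(sub_Con1_order hA (mem_cycle f p)).
  rewrite of_ -[p in (f ^+ p)]expn1 (orderXexp 1 of_) subn1 /=.
  by rewrite dvdn_Pexp2l ?prime_gt1 ?ltnn.
split; first exact: imset_f.
  by apply: contraNneq oXp => ->; apply: calE_sub_Eqs; apply: imset_f.
move=> _ _ /imsetP[F _ ->] /imsetP[G _ ->] defC.
have [g FGg g_f] :
    exists2 g : {ffun A -> A}, g \in F :|: G & Con1 g \subset Con1 f.
  apply/exists_inP; apply: contraNT oXp.
  rewrite negb_exists_in => /forall_inP ngt.
  rewrite defC -ConU; apply/subsetP=> k fp_k; apply: Con_glb => [|g FGg].
    by case/Con1P: fp_k.
  have [||/subsetP] := above g; last exact.
    by rewrite defC -ConU Con_sub1.
  by move=> g_f; move: (ngt g FGg); rewrite g_f.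
case/setUP: FGg => /Con_sub1 /subset_trans/(_ g_f) sub_f; [left | right].
  by apply/eqP; rewrite eqEsubset sub_f {1}defC subsetIl.
by apply/eqP; rewrite eqEsubset sub_f {1}defC subsetIr.
Qed.

End CongruenceLatticesOfPermutations.

Theorem theorem5p4 (A : finType) (hA : 3 <= #|A|) (f : {perm A})
    (hf : nontrivial f) :
  meet_irreducible (Con1 f) <->
  (exists p m : nat,
     [/\ prime p, 1 <= m, #[f]%g = p ^ m
       & 2 <= #|[set C in porbits f | #|C| == p ^ m]|]).
Proof.
have ntf : f != 1%g.
  by case: hf => ntf _; apply: contra_not_neq ntf => -> x; rewrite perm1.
split=> [irr_f | [p [m [p_pr]]]].
  have [p [m [p_pr of_]]] := meet_irreducible_prime_power hA ntf irr_f.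
  by exists p, m.+1; split=> //; apply: meet_irreducible_two_max_cycles.
case: m => // m _ of_ /card_gt1P[C [D []]].
rewrite !inE => /andP[/imsetP[x _ ->] /eqP max_x].
move=> /andP[/imsetP[y _ ->] /eqP max_y] neq_xy.
apply: (@two_max_cycles_meet_irreducible A f p m x y) => //.
- by rewrite of_ max_x.
- by rewrite of_ max_y.
by rewrite -eq_porbit_mem eq_sym.
Qed.
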